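(* Let $m\ge5$ be odd, $h=\frac{m-1}{2}$, $f_4(x)=x+x^3+x^{2^m-2^{h+2}+2}\in\mathbb{F}_{2^m}[x]$, and let $s^\infty$ be the sequence $s_t=\operatorname{Tr}(f_4(\alpha^t+1))$, $t\ge0$. Then the binary cyclic code $\mathcal{C}_s$ has parameters $[2^m-1,\,2^m-1-L_s,\,d(\mathcal{C}_s)]$, where $L_s=1+m(2^{(m-3)/2}+1)$ if $m\equiv1\pmod4$ and $L_s=1+m(2^{(m-3)/2}-1)$ if $m\equiv3\pmod4$, and $$\max\{8,\,2^{(m-5)/2}+2\}\le d(\mathcal{C}_s)\le 1+m(2^{(m-3)/2}+1)\quad\text{if } m\equiv 1\pmod 4,$$ $$2^{(m-5)/2}+2\le d(\mathcal{C}_s)\le 1+m(2^{(m-3)/2}-1)\quad\text{if } m\equiv 3\pmod 4.$$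
   Context: Let $v=2^m-1$, $\alpha$ a primitive element of $\mathbb{F}_{2^m}$, and $\operatorname{Tr}(x)=\sum_{i=0}^{m-1}x^{2^i}$ the absolute trace from $\mathbb{F}_{2^m}$ to $\mathbb{F}_2$. For a polynomial $F$ over $\mathbb{F}_{2^m}$ the binary sequence $s^\infty=(s_t)_{t\ge0}$ is defined by $s_t=\operatorname{Tr}(F(\alpha^t+1))$; it is periodic with period dividing $v$. Its minimal polynomial $g_s(x)$ is the polynomial $1+c_1x+\dots+c_Lx^L\in\mathbb{F}_2[x]$ of least degree $L$ such that $s_i+c_1s_{i-1}+\dots+c_Ls_{i-L}=0$ for all $i\ge L$; its degree $L_s$ is the linear span of $s^\infty$. $\mathcal{C}_s$ denotes the binary cyclic code of length $v$ with generator polynomial $g_s(x)$. $d(\mathcal{C})$ denotes minimum Hamming distance. *)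

(* Defs.v *)
From HB Require Import structures.
From mathcomp Require Import all_boot all_order all_algebra all_field.
Set Implicit Arguments. Unset Strict Implicit. Unset Printing Implicit Defensive.
Import GRing.Theory.
Local Open Scope ring_scope.

Definition trace (F : fieldType) (m : nat) (x : F) : F :=
  \sum_(i < m) x ^+ (2 ^ i).

Definition f4 (F : fieldType) (m : nat) (x : F) : F :=
  x + x ^+ 3 + x ^+ (2 ^ m - 2 ^ ((m - 1) %/ 2 + 2) + 2)%N.

Definition seq_s (F : fieldType) (m : nat) (alpha : F) (t : nat) : 'F_2 :=
  if trace m (f4 m (alpha ^+ t + 1)) == 0 then 0 else 1.

Definition annihilates (s : nat -> 'F_2) (g : {poly 'F_2}) : Prop :=
  g`_0 = 1 /\
  forall i : nat, ((size g).-1 <= i)%N ->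
    \sum_(j < size g) g`_j * s (i - j)%N = 0.

Definition is_min_poly (s : nat -> 'F_2) (g : {poly 'F_2}) : Prop :=
  annihilates s g /\ forall g', annihilates s g' -> (size g <= size g')%N.

Definition cyclic_code (v : nat) (g : {poly 'F_2}) : {set 'rV['F_2]_v} :=
  [set poly_rV ((rVpoly a * g) %% ('X^v - 1)) | a : 'rV['F_2]_v].

Definition wt (v : nat) (c : 'rV['F_2]_v) : nat := #|[set i | c 0 i != 0]|.

(* d is the minimum Hamming distance (= minimum nonzero weight, linear code) *)
Definition is_min_dist (v : nat) (C : {set 'rV['F_2]_v}) (d : nat) : Prop :=
  (exists2 c, c \in C & c != 0 /\ wt c = d) /\
  (forall c, c \in C -> c != 0 -> (d <= wt c)%N).

(* Main.v *)
Require Import Defs.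
From HB Require Import structures.
From mathcomp Require Import all_boot all_order all_algebra all_field.
From mathcomp Require Import zify ring.
Set Implicit Arguments. Unset Strict Implicit. Unset Printing Implicit Defensive.
Import GRing.Theory.
Local Open Scope ring_scope.

(* Write m = 2h+1. Since Tr(y^2) = Tr(y), the trace of f4(x+1) equals
     Tr(x) + Tr(x^3) + sum_(i < 2^(h-1)) (Tr(x^i) + Tr(x^(2^h+i))),
   which after cancellation modulo 2 is 1 plus the sum of Tr(x^n) over a set of
   2^(h-1) +- 1 odd numbers n < 2^(h+1). These n lie in distinct cyclotomic
   cosets of size m, so s_t is the sum of the t-th powers of
   1 + m(2^(h-1) +- 1) distinct roots of unity, and the minimal polynomial has
   exactly their inverses as roots.

   The set contains all odd n in [2^h, 2^h + 2^(h-1)), an arithmetic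
   progression of step 2; the BCH bound together with the parity of the weights
   (1 is a root) gives d >= 2^(h-2) + 2. The bound 8 only matters for m = 5,
   where 1, ..., 6 are zeros, and for m = 9, where the Hartmann-Tzeng bound
   applies. The upper bound is the weight of the generator polynomial, which is
   even while L + 1 is odd. *)

(** * Sums over ranges of natural numbers *)

Lemma big_nat_double (V : nmodType) (n : nat) (G : nat -> V) :
  \sum_(0 <= i < 2 * n) G i =
  \sum_(0 <= i < n) G (2 * i)%N + \sum_(0 <= i < n) G (2 * i).+1.
Proof.
elim: n => [|n IH]; first by rewrite !big_geq // addr0.
by rewrite mulnS !big_nat_recr //= IH -addrA addrACA.
Qed.

Lemma big_nat_window (T : Type) (idx : T) (op : Monoid.law idx) (G : nat -> T) (a n N : nat) :
  (a + n <= N)%N ->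
  \big[op/idx]_(0 <= j < N | (a <= j < a + n)%N) G j = \big[op/idx]_(0 <= i < n) G (a + i)%N.
Proof.
move=> le; transitivity (\big[op/idx]_(a <= j < a + n) G j).
  rewrite (@big_nat_widenl _ _ _ a 0) // (@big_nat_widen _ _ _ 0 (a + n) N) //.
by rewrite -{1}[a]add0n big_addn addKn; apply: eq_bigr => i _; rewrite addnC.
Qed.

(** * Locator bounds *)

(** Vandermonde independence: the relations combine to a weighted sum of values of any polynomial of
    size at most [size ks], and the product of the linear factors at all points but [y k0] isolates
    [c k0]. *)
Lemma power_sums_eq0 (F : fieldType) (I : eqType) (y c : I -> F) (ks : seq I) :
  uniq ks -> {in ks &, injective y} ->
  (forall i, (i < size ks)%N -> \sum_(k <- ks) c k * y k ^+ i = 0) ->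
  {in ks, forall k, c k = 0}.
Proof.
move=> uks yI sum0 k0 k0in.
pose P : {poly F} := \prod_(k <- rem k0 ks) ('X - (y k)%:P).
have sP : size P = size ks.
  by rewrite size_prod_XsubC size_rem // prednK //; case: (ks) k0in.
have : \sum_(k <- ks) c k * P.[y k] = 0.
  under eq_bigr do rewrite horner_coef mulr_sumr.
  rewrite exchange_big /= big1 // => i _.
  under eq_bigr do rewrite mulrCA.
  by rewrite -mulr_sumr sum0 ?mulr0 // -sP.
rewrite (big_rem k0) //= big_seq big1 => [|k kin].
  rewrite addr0 => /eqP; rewrite mulf_eq0 => /orP[/eqP //|].
  rewrite horner_prod prodf_seq_eq0 => /hasP[k kin] /=.
  rewrite hornerXsubC subr_eq0 => /eqP /yI; rewrite k0in (mem_rem kin) => /(_ isT isT) e.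
  by move: kin; rewrite -e mem_rem_uniqF.
apply/eqP; rewrite mulf_eq0 horner_prod prodf_seq_eq0; apply/orP; right.
by apply/hasP; exists k => //=; rewrite hornerXsubC subrr.
Qed.

(** The [ys] are the locators of a nonzero word and the sums its syndromes. With at most [delta]
    locators, the Vandermonde system on the distinct nodes [y ^+ a] would force every [y ^+ b] to
    vanish. *)
Lemma bch_bound (F : fieldType) (ys : seq F) (a b delta : nat) :
  uniq ys -> 0 \notin ys -> (0 < size ys)%N ->
  {in ys &, injective (fun y => y ^+ a)} ->
  (forall i, (i < delta)%N -> \sum_(y <- ys) y ^+ (b + a * i) = 0) ->
  (delta < size ys)%N.
Proof.
move=> uys y0 ne aI zeros; rewrite ltnNge; apply/negP => le.
have H : {in ys, forall y, y ^+ b = 0}.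
  apply: (power_sums_eq0 uys aI) => i lti.
  rewrite -[RHS](zeros i) ?(leq_trans lti) //.
  by apply: eq_bigr => y _; rewrite exprD exprM.
case: ys {uys aI zeros le} y0 ne H => // y ys; rewrite inE negb_or => /andP[y0 _] _ H.
by move: (H y (mem_head _ _)) => /eqP; rewrite expf_eq0 eq_sym (negPf y0) andbF.
Qed.

(* Subtracting from the second progression the multiple of the first by one
   locator cancels that locator, so one fewer unknown remains. *)
Lemma hartmann_tzeng_bound (F : fieldType) (ys : seq F) (a b delta : nat) :
  uniq ys -> 0 \notin ys -> (0 < size ys)%N -> (0 < delta)%N ->
  {in ys &, injective (fun y => y ^+ a)} ->
  (forall i, (i < delta)%N -> \sum_(y <- ys) y ^+ (b + a * i) = 0) ->
  (forall i, (i < delta)%N -> \sum_(y <- ys) y ^+ (b.+1 + a * i) = 0) ->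
  (delta.+1 < size ys)%N.
Proof.
move=> uys y0 ne d0 aI zeros1 zeros2; rewrite ltnNge; apply/negP => le.
(* As [delta] is positive, some locator is left once [z] is removed. *)
have lt1 := bch_bound uys y0 ne aI zeros1.
case: ys uys y0 ne aI zeros1 zeros2 le lt1 => // z ys uys y0 _ aI zeros1 zeros2 le lt1.
have {}uys1 : uniq ys by case/andP: uys.
have aI1 : {in ys &, injective (fun y => y ^+ a)}.
  by move=> u w ui wi; apply: aI; rewrite inE ?ui ?wi orbT.
have H : {in ys, forall y, y ^+ b * (y - z) = 0}.
  apply: (power_sums_eq0 uys1 aI1) => i lti.
  have ltd : (i < delta)%N by apply: leq_trans lti _.
  transitivity (\sum_(y <- z :: ys) y ^+ (b.+1 + a * i)
    - z * \sum_(y <- z :: ys) y ^+ (b + a * i)).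
    rewrite mulr_sumr -sumrB big_cons addSn exprS subrr add0r.
    by apply: eq_bigr => y _; rewrite exprS exprD exprM; ring.
  by rewrite zeros1 // zeros2 // mulr0 subr0.
case: ys uys y0 lt1 H {le aI zeros1 zeros2 uys1 aI1} => [|y ys] uys y0 lt1 H.
  by move: lt1 d0; rewrite /= ltnS; case: (delta).
move: (H y (mem_head _ _)) => /eqP; rewrite mulf_eq0 subr_eq0 expf_eq0.
move: uys y0; rewrite /= !inE !negb_or eq_sym => /andP[/andP[/negPf -> _] _].
by rewrite [_ == y]eq_sym => /and3P[_ /negPf -> _]; rewrite andbF.
Qed.

(** * Binary sequences given by power sums, and their cyclic codes *)

Definition F2_to (F : fieldType) (charF : 2 \in [pchar F]) (x : 'F_2) : F :=
  (x : nat)%:R.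

Section Embedding.
Variables (F : fieldType) (charF : 2 \in [pchar F]).

Fact F2_to_is_zmod_morphism : zmod_morphism (F2_to charF).
Proof.
move=> [[|[|//]] i] [[|[|//]] j]; rewrite /F2_to /= ?subrr ?subr0 //.
by rewrite sub0r (oppr_pchar2 charF).
Qed.

Fact F2_to_is_monoid_morphism : monoid_morphism (F2_to charF).
Proof.
split=> // [[[|[|//]] i] [[|[|//]] j]].
all: by rewrite /F2_to /= ?mul0r ?mulr0 ?mulr1.
Qed.

HB.instance Definition _ := GRing.isZmodMorphism.Build 'F_2 F (F2_to charF)
  F2_to_is_zmod_morphism.
HB.instance Definition _ := GRing.isMonoidMorphism.Build 'F_2 F (F2_to charF)
  F2_to_is_monoid_morphism.

Lemma F2_to_bool (b : bool) (x : F) :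
  x = b%:R -> F2_to charF (if x == 0 then 0 else 1) = x.
Proof. by move=> ->; case: b; rewrite ?oner_eq0 ?eqxx ?rmorph0 ?rmorph1. Qed.

(** The idempotents of a field are 0 and 1, so the zero test loses nothing. This reads [seq_s] and
    the polynomial [p] below back in [F]. *)
Lemma F2_to_idem (x : F) :
  x ^+ 2 = x -> F2_to charF (if x == 0 then 0 else 1) = x.
Proof.
move=> xx; apply: (F2_to_bool (b := x != 0)).
have: x * (x - 1) == 0 by rewrite mulrBr mulr1 -expr2 xx subrr.
by rewrite mulf_eq0 subr_eq0 => /orP[] /eqP ->; rewrite ?oner_eq0 ?eqxx.
Qed.

Local Notation emb := (F2_to charF).

Section MinimalPolynomial.
Variables (R : seq F) (s : nat -> 'F_2).
Hypotheses (uR : uniq R) (R0 : 0 \notin R) (Rsq : {in R, forall r, r ^+ 2 \in R}).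
Hypothesis sE : forall t, emb (s t) = \sum_(r <- R) r ^+ t.

(** Exchanging the sums and splitting r^(i-j) as r^i r^(-j) brings out the values g(r^-1). The bound
    on [i] keeps the truncated [i - j] exact. *)
Lemma recurrence_power_sums (g : {poly 'F_2}) i : ((size g).-1 <= i)%N ->
  emb (\sum_(j < size g) g`_j * s (i - j)%N) =
  \sum_(r <- R) (map_poly emb g).[r^-1] * r ^+ i.
Proof.
move=> lei; rewrite rmorph_sum /=.
under eq_bigr do rewrite rmorphM /= sE mulr_sumr.
rewrite exchange_big /= big_seq [RHS]big_seq; apply: eq_bigr => r rR.
have r0 : r != 0 by apply: contraNneq R0 => <-.
rewrite (horner_coef_wide _ (eq_leq (size_map_poly _ _))) mulr_suml; apply: eq_bigr => j _.
rewrite coef_map /= -mulrA; congr (_ * _).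
have lej : (j <= i)%N.
  by rewrite (leq_trans _ lei) // -ltnS (leq_trans (ltn_ord j)) // leqSpred.
by rewrite expfB_cond ?(negPf r0) // exprVn mulrC.
Qed.

(** The expected minimal polynomial over [F]: constant term 1, roots the inverses of [R]. *)
Let P : {poly F} := \prod_(r <- R) (1 - r *: 'X).

(** Squaring is injective and maps [R] into itself, so it permutes the factors of [P]; hence the
    coefficients lie in F_2 and [P] descends to [p]. *)
Let P_frobenius : map_poly (pFrobenius_aut charF) P = P.
Proof.
rewrite /P rmorph_prod /=.
under eq_bigr do rewrite rmorphB rmorph1 /= map_polyZ map_polyX /= pFrobenius_autE.
rewrite -(big_map (fun r => r ^+ 2) predT (fun r => 1 - r *: 'X)); apply: perm_big.
have u2 : uniq [seq r ^+ 2 | r <- R].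
  by rewrite map_inj_uniq // => x y; rewrite -!(pFrobenius_autE charF); apply: fmorph_inj.
have [|//|_] := uniq_min_size u2 (s2 := R) _ _; rewrite ?size_map //.
- by move=> _ /mapP[r rR ->]; apply: Rsq.
- exact: uniq_perm.
Qed.

Let p : {poly 'F_2} := \poly_(i < size P) (if P`_i == 0 then 0 else 1).

Let map_p : map_poly emb p = P.
Proof.
apply/polyP => i; rewrite coef_map /= coef_poly; case: ltnP => [_|le].
  by apply: F2_to_idem; rewrite -(pFrobenius_autE charF) -{2}P_frobenius coef_map.
by rewrite rmorph0 nth_default.
Qed.

Let P0 : P`_0 = 1.
Proof.
rewrite -horner_coef0 horner_prod big1 // => r _.
by rewrite !hornerE /= ?mulr0 ?subr0.
Qed.

Let sizeP : (size P <= (size R).+1)%N.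
Proof.
rewrite /P; elim: (R) => [|r R' IH]; first by rewrite big_nil size_poly1.
rewrite big_cons (leq_trans (size_polyMleq _ _)) //=.
have le2 : (size (1 - r *: 'X : {poly F})%R <= 2)%N.
  rewrite (leq_trans (size_polyD _ _)) // geq_max size_poly1 size_polyN.
  by rewrite (leq_trans (size_scale_leq _ _)) // size_polyX.
by rewrite -subn1 leq_subLR (leq_trans (leq_add le2 IH)).
Qed.

(** As many consecutive recurrences as [R] has elements form a Vandermonde system, so an
    annihilating [g] vanishes at every r^-1 and has degree at least [size R]; [p] attains this
    degree. *)
Lemma min_poly_of_power_sums (g : {poly 'F_2}) : is_min_poly s g ->
  size g = (size R).+1 /\ {in R, forall r, root (map_poly emb g) r^-1}.
Proof.
move=> [[g0 ann] gmin].
have groot : {in R, forall r, (map_poly emb g).[r^-1] = 0}.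
  (* The shift by [(size g).-1] moves all indices into the range where the recurrence holds. *)
  have H : {in R, forall r, (map_poly emb g).[r^-1] * r ^+ (size g).-1 = 0}.
    apply: (power_sums_eq0 (y := id)) => // i _.
    under eq_bigr do rewrite -mulrA -exprD.
    by rewrite -recurrence_power_sums ?leq_addr // ann ?leq_addr // rmorph0.
  move=> r rR; move: (H r rR) => /eqP; rewrite mulf_eq0 => /orP[/eqP //|].
  by rewrite expf_eq0 => /andP[_ /eqP r0]; rewrite r0 (negPf R0) in rR.
split; last by move=> r rR; apply/rootP/groot.
apply/eqP; rewrite eqn_leq; apply/andP; split; last first.
  have gn0 : map_poly emb g != 0.
    by rewrite map_poly_eq0; apply: contra_eq_neq g0 => ->; rewrite coef0 eq_sym oner_neq0.
  rewrite -(size_map_poly emb g) -(size_map (@GRing.inv F)); apply: max_poly_roots => //.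
    by apply/allP => _ /mapP[r rR ->]; apply/eqP/groot.
  by rewrite map_inj_uniq //; apply: invr_inj.
have szp : size p = size P by rewrite -map_p size_map_poly.
apply: leq_trans sizeP; rewrite -szp; apply: gmin; split.
  by apply: (fmorph_inj emb); rewrite -coef_map map_p P0 rmorph1.
move=> i lei; apply: (fmorph_inj emb); rewrite /= recurrence_power_sums // rmorph0 map_p.
rewrite big_seq big1 // => r rR; apply/eqP; rewrite mulf_eq0 horner_prod prodf_seq_eq0.
apply/orP; left; apply/hasP; exists r => //=.
by rewrite !hornerE /= mulfV ?subrr //; apply: contraNneq R0 => <-.
Qed.
End MinimalPolynomial.

Section Code.
Variables (R : seq F) (v : nat) (g : {poly 'F_2}).
Hypotheses (uR : uniq R) (Rv : {in R, forall r, r ^+ v = 1}) (v0 : (0 < v)%N).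
Hypothesis groot : {in R, forall r, root (map_poly emb g) r^-1}.
Hypothesis gsize : size g = (size R).+1.

(** By degree, the inverses of [R] are all the roots of [g], each simple and a v-th root of
    unity. *)
Lemma min_poly_dvd : g %| 'X^v - 1.
Proof.
rewrite -(dvdp_map emb) rmorphB /= rmorph1 map_polyXn.
have aroot : all (root (map_poly emb g)) [seq r^-1 | r <- R].
  by apply/allP => _ /mapP[r rR ->]; apply: groot.
have ur : uniq_roots [seq r^-1 | r <- R].
  by rewrite uniq_rootsE map_inj_uniq //; apply: invr_inj.
rewrite (all_roots_prod_XsubC _ aroot ur) ?size_map_poly ?size_map //.
rewrite dvdpZl ?lead_coef_eq0 -?size_poly_eq0 ?size_map_poly ?gsize //.
apply: uniq_roots_dvdp => //; apply/allP => _ /mapP[r rR ->].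
by rewrite rootE !hornerE exprVn Rv // invr1 subrr.
Qed.

(** With X^v - 1 = q g, a message matters only modulo q, so the codewords are the distinct products
    b g with b of size at most [v - size R]. *)
Lemma card_cyclic_code : #|cyclic_code v g| = (2 ^ (v - size R))%N.
Proof.
have [q Eq] := dvdpP _ _ min_poly_dvd.
have g0 : g != 0 by rewrite -size_poly_eq0 gsize.
have sX : size ('X^v - 1 : {poly 'F_2}) = v.+1.
  by rewrite -polyC1 size_XnsubC.
have q0 : q != 0 by apply: contra_eq_neq Eq => ->; rewrite mul0r -size_poly_eq0 sX.
have q1 : (0 < size q)%N by rewrite size_poly_gt0.
have sqR : (size q + size R = v.+1)%N.
  by rewrite -sX Eq size_mul // gsize addnS.
have leR : (size R <= v)%N by rewrite -ltnS -sqR -[X in (X < _)%N]add0n ltn_add2r.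
have sq : size q = (v - size R).+1 by rewrite -subSn // -sqR addnK.
pose f (b : 'rV['F_2]_(v - size R)) : 'rV['F_2]_v := poly_rV (rVpoly b * g).
have szr n (b : 'rV['F_2]_n) : (size (rVpoly b) <= n)%N := size_poly _ _.
have szf (b : 'rV['F_2]_(v - size R)) : (size (rVpoly b * g)%R <= v)%N.
  rewrite (leq_trans (size_polyMleq _ _)) // gsize addnS /=.
  by apply: leq_trans (leq_add (szr _ b) (leqnn (size R))) _; rewrite subnK.
have fI : injective f.
  move=> b b' /(congr1 rVpoly); rewrite !poly_rV_K // => /(mulIf g0) e.
  by rewrite -[b]rVpolyK e rVpolyK.
transitivity #|[set f b | b : 'rV['F_2]_(v - size R)]|; last first.
  by rewrite card_imset // card_mx card_Fp // mul1n.
congr (#|pred_of_set _|); apply/setP => c; apply/imsetP/imsetP => -[a _ ->].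
  have szm : (size (rVpoly a %% q)%R <= v - size R)%N by rewrite -ltnS -sq ltn_modp.
  exists (poly_rV (rVpoly a %% q)) => //; have := szf (poly_rV (rVpoly a %% q)).
  rewrite /f poly_rV_K // -ltnS -sX Eq {2}(divp_eq (rVpoly a) q) mulrDl -mulrA => szs.
  by rewrite modp_addl_mul_small.
exists (poly_rV (rVpoly a)) => //; rewrite /f poly_rV_K ?modp_small ?sX ?ltnS //.
exact: leq_trans (szr _ _) (leq_subr (size R) v).
Qed.

Lemma dvdp_rVpoly_cyclic_code (c : 'rV['F_2]_v) :
  c \in cyclic_code v g -> g %| rVpoly c.
Proof.
case/imsetP=> a _ ->; rewrite poly_rV_K; last first.
  rewrite -ltnS -(size_XnsubC (1 : 'F_2) v0) polyC1 ltn_modp.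
  by rewrite -polyC1 -size_poly_eq0 size_XnsubC.
by rewrite -(dvdp_mod _ min_poly_dvd) dvdp_mull.
Qed.

Lemma dvdp_power_sum (c : 'rV['F_2]_v) r : g %| rVpoly c -> r \in R ->
  \sum_(i | c 0 i != 0) r^-1 ^+ i = 0.
Proof.
move=> dv rR; have := groot rR.
have : map_poly emb g %| map_poly emb (rVpoly c) by rewrite dvdp_map.
move=> /root_dvdp /[apply] /rootP.
rewrite (@horner_coef_wide _ v); last by rewrite size_map_poly size_poly.
move=> H; rewrite big_mkcond -[RHS]H /=; apply: eq_bigr => i _.
rewrite coef_map /= coef_rVpoly_ord.
by case: (c 0 i) => [[|[|//]] lt]; rewrite /F2_to /= ?mul0r ?mul1r.
Qed.
End Code.
End Embedding.

(** * The exponents occurring in the trace expansion *)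

(* [selected k j] says that Tr(x^(2j+1)) occurs in the trace expansion of the
   sequence for m = 2k+5. The recursion reflects Tr(y^2) = Tr(y): passing from
   k to k+1 adds the odd exponents below 2^(k+2) and those in
   [2^(k+3), 2^(k+3) + 2^(k+2)), and the terms add modulo 2. *)
Fixpoint selected (k j : nat) : bool :=
  if k is k'.+1 then
    selected k' j (+) (j < 2 ^ k)%N (+) (2 ^ k.+1 <= j < 2 ^ k.+1 + 2 ^ k)%N
  else (j < 3)%N.

(** For positive [k], only the last toggle of the recursion reaches these indices. The resulting
    block feeds the BCH bound. *)
Lemma selected_top (k j : nat) : (2 ^ k.+1 <= j)%N ->
  selected k j = (j < 2 ^ k.+1 + 2 ^ k)%N.
Proof.
elim: k j => [|k IH] j //; rewrite [selected _ _]/=; move=> le.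
rewrite IH; first by move: le; rewrite !expnS; lia.
by move: le; rewrite !expnS; lia.
Qed.

Lemma selected_lt (k j : nat) : selected k j -> (j < 2 ^ k.+2)%N.
Proof.
case: (ltnP j (2 ^ k.+1)) => [lt _|le]; first by rewrite (ltn_trans lt) // ltn_exp2l.
by rewrite selected_top // => lt; rewrite (leq_trans lt) // !expnS; lia.
Qed.

(** [T i] stands for Tr(x^i). Doubling a range splits its sum by parity: the even terms reproduce
    the previous sum, the odd ones are a block toggled by [selected]. *)
Lemma sum_selected (V : comNzRingType) (T : nat -> V) (k : nat) :
  (forall x : V, x + x = 0) -> (forall i, T (2 * i)%N = T i) ->
  T 1%N + T 3%N + \sum_(0 <= i < 2 ^ k.+1) T i
    + \sum_(0 <= i < 2 ^ k.+1) T (2 ^ k.+2 + i)%N =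
  T 0%N + \sum_(0 <= j < 2 ^ k.+2 | selected k j) T (2 * j).+1.
Proof.
move=> V2 T2; elim: k => [|k IH].
  (* Here T 4 = T 2 = T 1, and one pair T 1 + T 1 cancels. *)
  rewrite !big_mkcond /= unlock /= (T2 2%N) (T2 1%N) !addr0.
  by rewrite -[RHS]addr0 -(V2 (T 1%N)); ring.
pose U j := T (2 * j).+1.
pose lo := \sum_(0 <= j < 2 ^ k.+1) U j.
pose hi := \sum_(0 <= j < 2 ^ k.+1) U (2 ^ k.+2 + j)%N.
transitivity (T 0%N + \sum_(0 <= j < 2 ^ k.+2 | selected k j) U j + lo + hi).
  have E1 : \sum_(0 <= i < 2 ^ k.+2) T i = \sum_(0 <= i < 2 ^ k.+1) T i + lo.
    rewrite [(2 ^ k.+2)%N]expnS big_nat_double; congr (_ + _).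
    exact: eq_bigr.
  have E2 : \sum_(0 <= i < 2 ^ k.+2) T (2 ^ k.+3 + i)%N =
      \sum_(0 <= i < 2 ^ k.+1) T (2 ^ k.+2 + i)%N + hi.
    rewrite [(2 ^ k.+2)%N in LHS]expnS big_nat_double [(2 ^ k.+3)%N]expnS; congr (_ + _).
      by apply: eq_bigr => i _; rewrite -mulnDr T2.
    by apply: eq_bigr => i _; rewrite addnS -mulnDr.
  by rewrite -IH E1 E2; ring.
rewrite -!addrA; congr (_ + _).
(* Over a common range, adding the three conditional terms modulo 2 is the exclusive or in
   [selected]. *)
transitivity (\sum_(0 <= j < 2 ^ k.+3) ((if selected k j then U j else 0)
   + ((if (0 <= j < 0 + 2 ^ k.+1)%N then U j else 0)
   + (if (2 ^ k.+2 <= j < 2 ^ k.+2 + 2 ^ k.+1)%N then U j else 0)))).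
  have W a n : (a + n <= 2 ^ k.+3)%N -> \sum_(0 <= j < 2 ^ k.+3)
      (if (a <= j < a + n)%N then U j else 0) = \sum_(0 <= i < n) U (a + i)%N.
    by move=> le; rewrite -big_mkcond big_nat_window.
  rewrite !big_split /= (W 0%N (2 ^ k.+1)%N) ?W; try by rewrite !expnS; lia.
  rewrite -big_mkcond /=.
  congr (_ + _).
  rewrite (big_nat_widen 0 (2 ^ k.+2) (2 ^ k.+3)) ?leq_exp2l //=.
  by apply: eq_bigl => j; case: (boolP (selected k j)) => // /selected_lt ->.
rewrite [RHS]big_mkcond; apply: eq_bigr => j _ /=; rewrite add0n.
by case: (selected k j) (_ < _)%N (_ <= _ < _)%N => -[] [];
  rewrite /= ?addr0 ?add0r ?V2 ?addr0.
Qed.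

(** Below 2^(k+1) exactly one of the two predicates holds, on the old top block both do, and the new
    top block belongs to [selected k.+1] alone. So the deviation of the count from 2^(k+1)
    alternates in sign. *)
Lemma count_selectedS (k : nat) :
  (\sum_(0 <= j < 2 ^ k.+3) selected k.+1 j + \sum_(0 <= j < 2 ^ k.+2) selected k j
   = 3 * 2 ^ k.+1)%N.
Proof.
rewrite (big_nat_widen 0 (2 ^ k.+2) (2 ^ k.+3)) ?leq_exp2l //=.
rewrite [X in (_ + X)%N]big_mkcond /= -big_split /=.
transitivity (\sum_(0 <= j < 2 ^ k.+3)
  ((0 <= j < 0 + 2 ^ k.+1) + ((2 ^ k.+1 <= j < 2 ^ k.+1 + 2 ^ k)
   + ((2 ^ k.+1 <= j < 2 ^ k.+1 + 2 ^ k) + (2 ^ k.+2 <= j < 2 ^ k.+2 + 2 ^ k.+1)))))%N.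
  apply: eq_bigr => j _.
  have := @selected_lt k j; have := @selected_top k j; rewrite !expnS.
  case: (selected k j) => /=; move: (2 ^ k)%N => n H1 H2; case: (ltnP j (2 * n)) => c1;
    case: (ltnP j (2 * (2 * n))) => c2 /=; lia.
have W a n : (a + n <= 2 ^ k.+3)%N -> (\sum_(0 <= j < 2 ^ k.+3) (a <= j < a + n) = n)%N.
  move=> le; transitivity (\sum_(0 <= j < 2 ^ k.+3 | a <= j < a + n) 1)%N.
    by rewrite [RHS]big_mkcond; apply: eq_bigr => j _; case: ifP.
  by rewrite big_nat_window // sum_nat_const_nat subn0 muln1.
by rewrite !big_split /= (W 0 (2 ^ k.+1))%N ?W; rewrite !expnS; lia.
Qed.

Lemma count_selected (k : nat) :
  (\sum_(0 <= j < 2 ^ k.+2) selected k j =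
   if odd k then 2 ^ k.+1 - 1 else 2 ^ k.+1 + 1)%N.
Proof.
elim: k => [|k IH]; first by rewrite unlock.
have := count_selectedS k; rewrite IH /= [(2 ^ k.+2)%N]expnS.
have : (0 < 2 ^ k.+1)%N by rewrite expn_gt0.
by case: (odd k) => /=; lia.
Qed.

(** * The absolute trace *)

Section Trace.
Variables (F : fieldType) (charF : 2 \in [pchar F]).

Lemma expr2nD a (x y : F) : (x + y) ^+ (2 ^ a) = x ^+ (2 ^ a) + y ^+ (2 ^ a).
Proof. by rewrite exprDn_pchar // pnatX pnatE // charF. Qed.

Lemma expr2n_sum a (I : Type) (r : seq I) (P : pred I) (G : I -> F) :
  (\sum_(i <- r | P i) G i) ^+ (2 ^ a) = \sum_(i <- r | P i) G i ^+ (2 ^ a).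
Proof.
apply: (big_morph (fun x : F => x ^+ (2 ^ a)) (expr2nD a)).
by rewrite expr0n expn_eq0.
Qed.

Lemma expr2n_inj a : injective (fun x : F => x ^+ (2 ^ a)).
Proof.
elim: a => [|a IH] x y /=; first by rewrite !expr1.
rewrite expnSr !exprM -!(pFrobenius_autE charF) => /fmorph_inj; exact: IH.
Qed.

(** This is (x^(2^r) + 1)/(x + 1) without the division: squaring the sum gives the even powers, and
    the extra factor x + 1 adds the odd ones. *)
Lemma geometric_sum_2n r (x : F) :
  (x + 1) ^+ (2 ^ r - 1) = \sum_(0 <= i < 2 ^ r) x ^+ i.
Proof.
elim: r => [|r IH]; first by rewrite big_nat1 subnn.
have -> : (2 ^ r.+1 - 1 = (2 ^ r - 1) * 2 + 1)%N.
  by rewrite expnS; have : (0 < 2 ^ r)%N by [rewrite expn_gt0]; lia.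
rewrite exprD exprM IH expr1 [(2 ^ r.+1)%N]expnS big_nat_double (expr2n_sum 1).
rewrite mulrDr mulr1 mulr_suml addrC; congr (_ + _); apply: eq_bigr => i _.
  by rewrite -exprM mulnC.
by rewrite -exprM -exprSr mulnC.
Qed.

Variable m : nat.
Hypothesis Fm : forall x : F, x ^+ (2 ^ m) = x.

Lemma traceD (x y : F) : trace m (x + y) = trace m x + trace m y.
Proof. by rewrite /trace -big_split /=; apply: eq_bigr => i _; rewrite expr2nD. Qed.

Lemma trace0 : trace m 0 = 0 :> F.
Proof. by rewrite /trace big1 // => i _; rewrite expr0n expn_eq0. Qed.

Lemma trace_sum (I : Type) (r : seq I) (P : pred I) (G : I -> F) :
  trace m (\sum_(i <- r | P i) G i) = \sum_(i <- r | P i) trace m (G i).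
Proof. exact: (big_morph _ traceD trace0). Qed.

Lemma trace_sqr (x : F) : trace m (x ^+ 2) = trace m x.
Proof.
(* With [x] added, both sides are the sum of x^(2^i) over i <= m. *)
apply: (addIr x); transitivity (\sum_(i < m.+1) x ^+ (2 ^ i)); last first.
  by rewrite big_ord_recr /= Fm.
rewrite big_ord_recl expr1 addrC; congr (_ + _).
by apply: eq_bigr => i _; rewrite -exprM /= -expnS.
Qed.

Lemma trace_expr2n a (x : F) : trace m (x ^+ (2 ^ a)) = trace m x.
Proof. by elim: a => [|a IH]; rewrite ?expr1 // expnSr exprM trace_sqr. Qed.

Lemma trace_idem (x : F) : trace m x ^+ 2 = trace m x.
Proof.
rewrite -[RHS]trace_sqr /trace (expr2n_sum 1).
by apply: eq_bigr => i _; rewrite -!exprM mulnC.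
Qed.

Lemma trace1 : odd m -> trace m 1 = 1 :> F.
Proof.
move=> om; rewrite /trace; under eq_bigr do rewrite expr1n.
rewrite sumr_const card_ord -[m]odd_double_half om mulrnDr -mul2n mulrnA.
by rewrite (pcharf0 charF) mul0rn addr0.
Qed.

(* Cyclic shifts of the exponent turn the last term of [f4] into two blocks of
   consecutive exponents; here m = 2h+3. *)
Lemma trace_f4 h (x : F) : m = h.+1.*2.+1 ->
  trace m (f4 m (x + 1)) =
  trace m (x ^+ 1) + trace m (x ^+ 3) + \sum_(0 <= i < 2 ^ h) trace m (x ^+ i)
  + \sum_(0 <= i < 2 ^ h) trace m (x ^+ (2 ^ h.+1 + i)).
Proof.
move=> Em; rewrite /f4.
have -> : ((m - 1) %/ 2 + 2 = h.+3)%N by rewrite Em; lia.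
(* Since m = h + (h+3). The outer 2 disappears under the trace, and the factor 2^h - 1 yields the
   geometric sum [S]. *)
have -> : (2 ^ m - 2 ^ h.+3 + 2 = ((2 ^ h - 1) * 2 ^ h.+2 + 1) * 2)%N.
  rewrite Em (_ : h.+1.*2.+1 = h + h.+3)%N; last by rewrite -addnn; lia.
  by rewrite expnD mulnDl -mulnA -expnSr mulnBl mul1n.
set S := \sum_(0 <= i < 2 ^ h) x ^+ i.
have V2 (y : F) : y + y = 0 by rewrite -mulr2n mulrn_pchar.
rewrite !traceD [X in _ + _ + X](_ : _ = trace m S + trace m (S * x ^+ (2 ^ h.+1))).
  have -> : (x + 1) ^+ 3 = x ^+ 3 + x ^+ 2 + x + 1 + (x ^+ 2 + x ^+ 2 + (x + x)) by ring.
  rewrite !V2 !addr0 !traceD trace_sqr /S mulr_suml !trace_sum expr1.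
  under [X in _ + (_ + X)]eq_bigr do rewrite -exprD addnC.
  have -> (a b c d e : F) : a + b + (c + a + a + b) + (d + e) = a + c + d + e + (a + a + (b + b)).
    by ring.
  by rewrite !V2 !addr0.
rewrite exprM trace_sqr exprD expr1 exprM geometric_sum_2n -/S mulrDr mulr1 traceD addrC.
(* Raising to the power 2^(h+1) turns S^(2^(h+2)) into S^(2^m) = S. *)
rewrite trace_expr2n; congr (_ + _); rewrite -(trace_expr2n h.+1) exprMn -exprM -expnD.
by rewrite (_ : h.+2 + h.+1 = m)%N ?Fm // Em -addnn; lia.
Qed.
End Trace.

(** * The roots of unity behind the sequence *)

Section Zeros.
Variables (F : fieldType) (charF : 2 \in [pchar F]) (k m : nat).
Hypothesis mE : m = k.+2.*2.+1.
Let v := (2 ^ m - 1)%N.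
Variable alpha : F.
Hypothesis alphaP : v.-primitive_root alpha.
Hypothesis Fm : forall x : F, x ^+ (2 ^ m) = x.

(** The leading 1 carries the constant Tr(1); the rest are the conjugates of the selected odd
    powers. *)
Definition sequence_roots : seq F :=
  1 :: [seq alpha ^+ ((2 * j).+1 * 2 ^ i) |
         j <- [seq j <- index_iota 0 (2 ^ k.+2) | selected k j], i <- iota 0 m].

Lemma mem_sequence_roots j i : selected k j ->
  alpha ^+ ((2 * j).+1 * 2 ^ i) \in sequence_roots.
Proof.
move=> sj; have E : alpha ^+ ((2 * j).+1 * 2 ^ i) = alpha ^+ ((2 * j).+1 * 2 ^ (i %% m)).
  rewrite {1}(divn_eq i m) expnD mulnA exprM [RHS]exprM; congr (_ ^+ _).
  elim: (i %/ m)%N => [|q IH]; first by rewrite muln1.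
  by rewrite [(q.+1 * m)%N]mulSn expnD mulnCA mulnC exprM IH Fm.
rewrite inE E; apply/orP; right; apply/allpairsP; exists (j, (i %% m)%N).
by rewrite mem_filter sj mem_index_iota mem_iota add0n ltn_mod mE (selected_lt sj).
Qed.

Lemma sequence_roots_sqr : {in sequence_roots, forall r, r ^+ 2 \in sequence_roots}.
Proof.
move=> r; rewrite inE => /predU1P[->|]; first by rewrite expr1n mem_head.
case/allpairsP=> -[j i] /= []; rewrite mem_filter => /andP[sj _] _ ->.
by rewrite -exprM -mulnA -expnSr mem_sequence_roots.
Qed.

Lemma sequence_roots_order : {in sequence_roots, forall r, r ^+ v = 1}.
Proof.
move=> r; rewrite inE => /predU1P[->|]; first by rewrite expr1n.
by case/allpairsP=> -[j i] /= [_ _ ->]; rewrite exprAC (prim_expr_order alphaP) expr1n.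
Qed.

(** Both exponents are below [v], so they agree as integers, and the parity of [b] excludes d >
    0. *)
Let eq_expr_small a b d : odd b -> (0 < a < 2 ^ k.+3)%N -> (b < 2 ^ k.+3)%N ->
  (d <= k.+2)%N -> alpha ^+ (a * 2 ^ d) = alpha ^+ b -> a = b /\ d = 0%N.
Proof.
move=> ob /andP[a0 lta] ltb led /eqP; rewrite (eq_prim_root_expr alphaP).
have vE : (v = 2 ^ k.+3 * 2 ^ k.+2 - 1)%N.
  by rewrite /v -expnD (_ : m = k.+3 + k.+2)%N // mE -addnn; lia.
have p2 : (4 <= 2 ^ k.+2)%N by rewrite (leq_exp2l 2 k.+2 (m:=2)).
rewrite !modn_small; first last.
- have : (2 ^ d <= 2 ^ k.+2)%N by rewrite leq_exp2l.
  by rewrite vE; move: lta p2; rewrite [(2 ^ k.+3)%N]expnS; nia.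
- by rewrite vE; move: ltb p2; rewrite [(2 ^ k.+3)%N]expnS; nia.
move=> /eqP e; move: ob; rewrite -e oddM oddX orbF.
by case: d {led} e => [|d] /=; rewrite ?muln1 ?andbF.
Qed.

Lemma sequence_roots_uniq : uniq sequence_roots.
Proof.
have shift a : alpha ^+ (a * 2 ^ m) = alpha ^+ a by rewrite exprM Fm.
have small j : j \in [seq j <- index_iota 0 (2 ^ k.+2) | selected k j] ->
    ((2 * j).+1 < 2 ^ k.+3)%N.
  by rewrite mem_filter mem_index_iota => /andP[_ /andP[_]]; rewrite [(2 ^ k.+3)%N]expnS; lia.
apply/andP; split.
  apply/allpairsP => -[[j i] /= [/small jS _ e]].
  have : alpha ^+ (2 * j).+1 = 1.
    by apply: (expr2n_inj charF (a := i)); rewrite /= -exprM -e expr1n.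
  move/eqP; rewrite -(prim_order_dvd alphaP) => /dvdn_leq; rewrite /v (_ : m = k.+3 + k.+2)%N.
    have p2 : (4 <= 2 ^ k.+2)%N by rewrite (leq_exp2l 2 k.+2 (m:=2)).
    by rewrite expnD => /(_ isT); nia.
  by rewrite mE -addnn; lia.
apply: allpairs_uniq; rewrite ?filter_uniq ?iota_uniq //.
have main j i j' i' : ((2 * j).+1 < 2 ^ k.+3)%N -> ((2 * j').+1 < 2 ^ k.+3)%N ->
    (i < m)%N -> (i' <= i)%N ->
    alpha ^+ ((2 * j).+1 * 2 ^ i) = alpha ^+ ((2 * j').+1 * 2 ^ i') -> (j, i) = (j', i').
  move=> lj lj' li le; rewrite -(subnK le) expnD mulnA exprM [RHS]exprM.
  have oj n : odd (2 * n).+1 by rewrite /= mul2n odd_double.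
  move/(expr2n_inj charF); case: (leqP (i - i') k.+2) => [led|gtd] e.
    have [] := eq_expr_small (oj j') _ lj' led e; first by rewrite lj.
    by move=> [ej] d0; congr (_, _); lia.
  (* A shift larger than k+2 is traded for its complement modulo m = 2k+5, which is at most k+2,
     with the roles of j and j' exchanged. *)
  have := congr1 (fun x => x ^+ (2 ^ (m - (i - i')))) e.
  rewrite /= -!exprM -mulnA -expnD subnKC; last by lia.
  rewrite shift => /esym e'.
  have [] := eq_expr_small (oj j) _ lj _ e'; rewrite ?lj' //; rewrite mE -addnn in li *; lia.
move=> [j i] [j' i'] /allpairsP[[a b] [ha hb [-> ->]]] /allpairsP[[a' b'] [ha' hb' [-> ->]]].
rewrite /= in ha ha' *; rewrite !mem_iota !add0n /= in hb hb'.
case: (leqP b' b) => [le|/ltnW le] e; first by apply: main => //; apply: small.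
by apply/esym/main => //; apply: small.
Qed.

Lemma size_sequence_roots :
  size sequence_roots =
  (1 + m * (if odd k then 2 ^ k.+1 - 1 else 2 ^ k.+1 + 1))%N.
Proof.
rewrite /= size_allpairs size_iota mulnC -count_selected size_filter -sum1_count.
by rewrite [in LHS]big_mkcond.
Qed.

Lemma seq_s_power_sum t :
  F2_to charF (seq_s m alpha t) = \sum_(r <- sequence_roots) r ^+ t.
Proof.
rewrite /seq_s F2_to_idem ?trace_idem // (trace_f4 charF Fm (h := k.+1)) //.
have V2 (x : F) : x + x = 0 by rewrite -mulr2n mulrn_pchar.
pose T n := trace m ((alpha ^+ t) ^+ n).
have T2 n : T (2 * n)%N = T n by rewrite /T mulnC exprM trace_sqr.
have om : odd m by rewrite mE /= odd_double.
rewrite -/(T 1%N) (sum_selected k V2 T2) big_cons expr1n /T expr0 (trace1 charF om).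
congr (_ + _); rewrite big_allpairs_dep big_filter; apply: eq_bigr => j _.
rewrite /trace -(big_mkord xpredT (fun i => ((alpha ^+ t) ^+ (2 * j).+1) ^+ (2 ^ i))).
rewrite /index_iota subn0; apply: eq_bigr => i _.
by rewrite -!exprM mulnC.
Qed.
End Zeros.

(** * Weights of the codewords *)

Lemma wt_gt0 (v : nat) (c : 'rV['F_2]_v) : c != 0 -> (0 < wt c)%N.
Proof.
apply: contraTT; rewrite -eqn0Ngt cards_eq0 => /eqP c0; apply/negPn/eqP/rowP => i.
by rewrite mxE; apply/eqP/negPn; have := in_set0 i; rewrite -c0 inE => ->.
Qed.

Lemma wt_poly_rV (v : nat) (p : {poly 'F_2}) :
  (wt (poly_rV p : 'rV_v) <= size p)%N.
Proof.
rewrite /wt -sum1_card -[leqRHS]muln1 -[size p]card_ord -sum_nat_const.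
case: (leqP (size p) v) => [le|/ltnW le].
  rewrite (big_ord_widen v (fun _ => 1%N) le) big_mkcond [leqRHS]big_mkcond /=.
  apply: leq_sum => i _; rewrite inE mxE; case: (ltnP i (size p)) => [_|ge]; first by case: ifP.
  by rewrite nth_default ?eqxx.
by rewrite !sum1_card card_ord (leq_trans (max_card _)) // card_ord.
Qed.

Section Distance.
Variables (F : fieldType) (charF : 2 \in [pchar F]) (k m : nat).
Hypothesis mE : m = k.+2.*2.+1.
Let v := (2 ^ m - 1)%N.
Variable alpha : F.
Hypothesis alphaP : v.-primitive_root alpha.
Hypothesis Fm : forall x : F, x ^+ (2 ^ m) = x.
Variable g : {poly 'F_2}.
Hypothesis groot : {in sequence_roots k m alpha,
  forall r, root (map_poly (F2_to charF) g) r^-1}.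
Variable c : 'rV['F_2]_v.
Hypotheses (gc : g %| rVpoly c) (c0 : c != 0).

(** Locators are powers of the inverse of [alpha] because [g] vanishes at the inverses of
    [sequence_roots]. *)
Let ys : seq F := [seq alpha^-1 ^+ (i : 'I_v) | i <- enum [set i | c 0 i != 0]].

Let size_ys : size ys = wt c.
Proof. by rewrite size_map -cardE. Qed.

Let ys_gt0 : (0 < size ys)%N.
Proof. by rewrite size_ys wt_gt0. Qed.

Let uniq_ys : uniq ys.
Proof.
rewrite map_inj_uniq ?enum_uniq // => i j; rewrite !exprVn => /invr_inj /eqP.
by rewrite (eq_prim_root_expr alphaP) !modn_small // => /eqP /val_inj.
Qed.

Let ys_order y : y \in ys -> y ^+ v = 1.
Proof. by case/mapP=> i _ ->; rewrite exprAC exprVn (prim_expr_order alphaP) invr1 expr1n. Qed.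

Let ys_neq0 : 0 \notin ys.
Proof.
apply/negP => /ys_order /eqP.
by rewrite expr0n gtn_eqF ?(prim_order_gt0 alphaP) // eq_sym oner_eq0.
Qed.

Let power_sum n : alpha ^+ n \in sequence_roots k m alpha -> \sum_(y <- ys) y ^+ n = 0.
Proof.
move=> nR; rewrite -[RHS](dvdp_power_sum groot gc nR) big_map big_enum /=.
by apply: eq_big => [i|i _]; [rewrite inE | rewrite exprAC [alpha^-1 ^+ n]exprVn].
Qed.

Let selected_sum j i n : selected k j -> n = ((2 * j).+1 * 2 ^ i)%N ->
  \sum_(y <- ys) y ^+ n = 0.
Proof. by move=> sj ->; apply/power_sum/mem_sequence_roots. Qed.

Lemma wt_even : ~~ odd (wt c).
Proof.
have : \sum_(y <- ys) y ^+ 0 = 0 by rewrite power_sum // expr0 mem_head.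
rewrite big_const_seq count_predT iter_addr_0 => /eqP.
by rewrite -(dvdn_pcharf charF) dvdn2 size_ys.
Qed.

Let sqr_inj : {in ys &, injective (fun y => y ^+ 2)}.
Proof. by move=> x y _ _; apply: (@expr2n_inj F charF 1). Qed.

(** The top block gives the 2^k zeros 2^(k+2) + 1 + 2i, a progression of step 2, and squaring is
    injective in characteristic 2. *)
Lemma wt_ge_top_block : (2 ^ k < wt c)%N.
Proof.
rewrite -size_ys; apply: (@bch_bound F ys 2 (2 * 2 ^ k.+1).+1) => // i lti.
apply: (@selected_sum (2 ^ k.+1 + i) 0); last by rewrite muln1 mulnDr.
by rewrite selected_top ?leq_addr // ltn_add2l.
Qed.

Lemma wt_ge8_m5 : k = 0%N -> (8 <= wt c)%N.
Proof.
move=> k0; suff : (6 < wt c)%N.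
  by move: wt_even; lia.
rewrite -size_ys; apply: (@bch_bound F ys 1 1) => // i lti.
(* Each of 1, ..., 6 is a power of two times 1, 3 or 5, the exponents selected for k = 0. *)
have S (j a : nat) : (j < 3)%N -> (1 + 1 * i = (2 * j).+1 * 2 ^ a)%N ->
   \sum_(y <- ys) y ^+ (1 + 1 * i) = 0.
  by move=> lj; apply: selected_sum; rewrite k0.
case: i lti S => [|[|[|[|[|[|//]]]]]] _ S.
- exact: (S 0 0)%N.
- exact: (S 0 1)%N.
- exact: (S 1 0)%N.
- exact: (S 0 2)%N.
- exact: (S 2 0)%N.
- exact: (S 1 1)%N.
Qed.

(* For m = 9 the defining set contains {1, 6, 11, 16, 21} and its translate by
   one, but no suitable progression longer than five. *)
Lemma wt_ge8_m9 : k = 2%N -> (8 <= wt c)%N.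
Proof.
move=> k2; suff : (6 < wt c)%N.
  by move: wt_even; lia.
have S (j a n : nat) : selected 2 j -> (n == (2 * j).+1 * 2 ^ a)%N ->
   \sum_(y <- ys) y ^+ n = 0.
  by move=> sj /eqP; apply: selected_sum; rewrite k2.
rewrite -size_ys; apply: (@hartmann_tzeng_bound F ys 5 1 5) => //.
(* 409 is the inverse of 5 modulo v = 511, so fifth powers separate the locators. *)
- have root5 y : y \in ys -> (y ^+ 5) ^+ 409 = y.
    move=> /ys_order y1; rewrite -exprM (_ : 5 * 409 = v * 4 + 1)%N; last by rewrite /v mE k2.
    by rewrite exprD exprM y1 expr1n mul1r.
  by move=> x y /root5 xE /root5 yE e; rewrite -xE -yE /= e.
- case=> [|[|[|[|[|//]]]]] _.
  + exact: (S 0 0)%N.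
  + exact: (S 1 1)%N.
  + exact: (S 5 0)%N.
  + exact: (S 0 4)%N.
  + exact: (S 10 0)%N.
- case=> [|[|[|[|[|//]]]]] _.
  + exact: (S 0 1)%N.
  + exact: (S 3 0)%N.
  + exact: (S 1 2)%N.
  + exact: (S 8 0)%N.
  + exact: (S 5 1)%N.
Qed.

(** The weight exceeds 2^k, and both are even. *)
Lemma wt_ge : (0 < k)%N -> (2 ^ k + 2 <= wt c)%N.
Proof.
move=> k0; have := wt_ge_top_block; have := wt_even.
have : ~~ odd (2 ^ k) by rewrite oddX orbF -lt0n.
by lia.
Qed.

Lemma wt_ge_even : ~~ odd k -> (maxn 8 (2 ^ k + 2) <= wt c)%N.
Proof.
move=> ok; rewrite geq_max.
case: (posnP k) => [k0|k0].
  by have w8 := wt_ge8_m5 k0; rewrite w8 k0 (leq_trans _ w8).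
rewrite wt_ge // andbT; case: (ltnP k 3) => [lt3|le3].
  by apply: wt_ge8_m9; move: k0 lt3 ok; case: (k) => [|[|[|]]].
(* From k = 3 on, 2^k is already at least 8. *)
by rewrite (leq_trans _ (wt_ge k0)) // (leq_trans _ (leq_addr _ _)) // (leq_exp2l 3 k (m := 2)).
Qed.
End Distance.

Theorem theorem4 (F : finFieldType) (m : nat) (alpha : F)
    (hm5 : (5 <= m)%N) (hmodd : odd m) (hcard : #|F| = (2 ^ m)%N)
    (halpha : (2 ^ m - 1)%N.-primitive_root alpha)
    (g : {poly 'F_2}) (hg : is_min_poly (seq_s m alpha) g) :
  let v := (2 ^ m - 1)%N in
  let L := (size g).-1 in
  let C := cyclic_code v g in
  #|C| = (2 ^ (v - L))%N /\
  ((m %% 4 = 1)%N ->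
     L = (1 + m * (2 ^ ((m - 3) %/ 2) + 1))%N /\
     forall d, is_min_dist C d ->
       (maxn 8 (2 ^ ((m - 5) %/ 2) + 2) <= d)%N /\
       (d <= 1 + m * (2 ^ ((m - 3) %/ 2) + 1))%N) /\
  ((m %% 4 = 3)%N ->
     L = (1 + m * (2 ^ ((m - 3) %/ 2) - 1))%N /\
     forall d, is_min_dist C d ->
       (2 ^ ((m - 5) %/ 2) + 2 <= d)%N /\
       (d <= 1 + m * (2 ^ ((m - 3) %/ 2) - 1))%N).
Proof.
move=> v L C.
have charF : 2 \in [pchar F] by apply: card_finPcharP hcard _.
have Fm (x : F) : x ^+ (2 ^ m) = x by rewrite -hcard expf_card.
pose k := ((m - 5) %/ 2)%N.
have mE : m = k.+2.*2.+1 by rewrite /k; lia.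
have -> : ((m - 3) %/ 2 = k.+1)%N by rewrite mE; lia.
rewrite -/k; clearbody k.
pose R := sequence_roots k m alpha.
have uR : uniq R := sequence_roots_uniq charF mE halpha Fm.
have Rv : {in R, forall r, r ^+ v = 1} := sequence_roots_order halpha.
have v0 : (0 < v)%N := prim_order_gt0 halpha.
have R0 : 0 \notin R.
  by apply/negP => /Rv /eqP; rewrite expr0n gtn_eqF // eq_sym oner_eq0.
have [gsize groot] := min_poly_of_power_sums uR R0 (sequence_roots_sqr mE Fm)
  (seq_s_power_sum charF mE alpha Fm) hg.
have LE : L = size R by rewrite /L gsize.
have sR : size R = _ := size_sequence_roots k m alpha.
have dvC := dvdp_rVpoly_cyclic_code uR Rv v0 groot gsize.
have upper d : is_min_dist C d -> (d <= size R)%N.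
  move=> [_ dmin].
  (* This makes [g] itself a codeword, neither truncated nor reduced modulo X^v - 1. *)
  have szg : (size g <= v)%N.
    have lek : (k.+2 <= 2 ^ k.+1)%N by apply: ltn_expl.
    have v_ge : (2 + m * (2 ^ k.+1 + 1) <= v)%N.
      (* With u = 2^(k+1), v = 8u^2 - 1 while m = 2k+5 is at most 2u + 1. *)
      rewrite /v mE (_ : 2 ^ k.+2.*2.+1 = 8 * (2 ^ k.+1 * 2 ^ k.+1))%N.
        by move: lek; rewrite -addnn; move: (2 ^ k.+1)%N => u; nia.
      by rewrite -expnD -(expnD 2 3); congr (2 ^ _)%N; rewrite -addnn; lia.
    rewrite gsize sR -addSn (leq_trans _ v_ge) // leq_add2l leq_mul2l.
    by case: (odd k); lia.
  pose cg : 'rV['F_2]_v := poly_rV g.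
  have cgE : rVpoly cg = g by rewrite poly_rV_K.
  have cgC : cg \in C.
    apply/imsetP; exists (poly_rV 1) => //; rewrite poly_rV_K ?size_poly1 // mul1r modp_small //.
    by rewrite -polyC1 size_XnsubC.
  have cg0 : cg != 0.
    by apply: contra_eq_neq gsize => e; rewrite -cgE e linear0 size_poly0.
  apply: leq_trans (dmin _ cgC cg0) _.
  (* Weight [size R + 1] is excluded: weights are even, and [size R] is one plus a product of two
     odd numbers, hence even. *)
  have := wt_poly_rV v g; rewrite gsize leq_eqVlt => /predU1P[e|//].
  have := wt_even groot (dvC _ cgC); rewrite e oddS negbK sR.
  by case: (odd k); rewrite /= oddM mE /= odd_double /= ?oddB ?oddD ?expn_gt0 // oddX.
split; first by rewrite LE; apply: card_cyclic_code.
split=> mmod; rewrite LE sR.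
  have ok : odd k = false by rewrite mE in mmod; lia.
  rewrite ok; split=> // d dC; have := upper d dC; rewrite sR ok; split=> //.
  case: dC => -[c cC [c0 <-]] _.
  by apply: (wt_ge_even mE halpha Fm groot (dvC _ cC) c0); rewrite ok.
have ok : odd k by rewrite mE in mmod; lia.
rewrite ok; split=> // d dC; have := upper d dC; rewrite sR ok; split=> //.
case: dC => -[c cC [c0 <-]] _.
by apply: (wt_ge mE halpha Fm groot (dvC _ cC) c0); apply: odd_gt0.
Qed.
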